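(* Let $(M^2,\nabla,\Omega)$ be an equi-affine 2-manifold and let $\alpha\colon I\to M^2$ be a nondegenerate curve. Put $$\psi=\big(\Omega(\alpha',\nabla_{\alpha'}\alpha')\big)^{-1/3}\colon I\to\mathbb R\setminus\{0\}.$$ Then the equi-affine curvature $\kappa_a\colon I\to\mathbb R$ of $\alpha$ is given by $$\kappa_a=-\tfrac12(\psi^2)''+\psi^5\,\Omega\big(\nabla_{\alpha'}\alpha',\nabla^2_{\alpha'}\alpha'\big).$$
   Context: An equi-affine 2-manifold $(M^2,\nabla,\Omega)$ is a connected 2-dimensional smooth manifold $M^2$ with a symmetric (torsion-free) affine connection $\nabla$ and a volume form $\Omega$ (nowhere vanishing 2-form) that is parallel, $\nabla\Omega=0$. For a smooth curve $\alpha\colon I\to M^2$ ($I$ an open interval), $\nabla_{\alpha'}$ denotes covariant differentiation of vector fields along $\alpha$ with respect to the parameter $t\in I$, and $\nabla^2_{\alpha'}\alpha'=\nabla_{\alpha'}(\nabla_{\alpha'}\alpha')$. Primes on functions on $I$ denote derivatives in $t$. Cube roots are real cube roots (of possibly negative numbers). The curve $\alpha$ is nondegenerate if $\Omega(\alpha'(t),(\nabla_{\alpha'}\alpha')(t))\neq0$ for every $t\in I$. Equi-affine curvature: let $\alpha\colon I\to M^2$ be nondegenerate, put $\mu=\sqrt[3]{\Omega(\alpha',\nabla_{\alpha'}\alpha')}$ and, for some $t_0\in I$, $\sigma(t)=\int_{t_0}^t\mu(u)\,du$ (equi-affine arclength parameter). Then $\sigma'=\mu\ne0$, so $\sigma\colon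 I\to J=\sigma(I)$ is a diffeomorphism onto an open interval $J$; let $\overline\alpha\colon J\to M^2$ be the reparametrization with $\alpha=\overline\alpha\circ\sigma$. It satisfies $\Omega(\overline\alpha',\nabla_{\overline\alpha'}\overline\alpha')=1$, hence $\Omega(\overline\alpha',\nabla^2_{\overline\alpha'}\overline\alpha')=0$, so there is a unique function $\overline\kappa_a$ on $J$ with $\nabla^2_{\overline\alpha'}\overline\alpha'=-\overline\kappa_a\,\overline\alpha'$. The equi-affine curvature of $\alpha$ is $\kappa_a=\overline\kappa_a\circ\sigma\colon I\to\mathbb R$ (independent of $t_0$). *)

(* Defs.v *)
From HB Require Import structures.
From mathcomp Require Import all_boot all_order all_algebra.
From mathcomp Require Import all_classical all_reals all_analysis.

Set Implicit Arguments.
Unset Strict Implicit.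
Unset Printing Implicit Defensive.

Import Order.TTheory GRing.Theory Num.Theory.
Import numFieldNormedType.Exports.

Local Open Scope classical_set_scope.
Local Open Scope ring_scope.

(* C^n on an open set U, for a finite-dimensional domain E: f is differentiable
   on U and all its directional derivatives are C^(n-1). *)
Fixpoint Cn {R : realType} {E W : normedModType R}
    (n : nat) (U : set E) (f : E -> W) : Prop :=
  if n is m.+1 then
    (forall x, U x -> differentiable f x) /\ (forall v, Cn m U ('D_v f))
  else forall x, U x -> {for x, continuous f}.

Definition Cinfty {R : realType} {E W : normedModType R}
    (U : set E) (f : E -> W) : Prop := forall n, Cn n U f.

(* A connected smooth 2-manifold structure on M, given by an atlas (not
   necessarily maximal) of charts.  chart_inv i is the inverse of chart_map i;
   the values of chart_map i outside chart_dom i, and of chart_inv i outside the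
   image of chart_dom i, are irrelevant. *)
Record surface (R : realType) (M : topologicalType) := Surface {
  chart : Type;
  chart_dom : chart -> set M;
  chart_map : chart -> M -> 'rV[R]_2;
  chart_inv : chart -> 'rV[R]_2 -> M;
  surface_hausdorff : hausdorff_space M;
  surface_second_countable : @second_countable M;
  surface_connected : connected [set: M];
  chart_cover : forall p, exists i, chart_dom i p;
  chart_open : forall i, open (chart_dom i);
  chart_image_open : forall i, open (chart_map i @` chart_dom i);
  chart_mapK : forall i p, chart_dom i p -> chart_inv i (chart_map i p) = p;
  chart_map_continuous : forall i p, chart_dom i p ->
    {for p, continuous (chart_map i)};
  chart_inv_continuous : forall i x, (chart_map i @` chart_dom i) x ->
    {for x, continuous (chart_inv i)};
  transition_smooth : forall i j,
    Cinfty (chart_map i @` (chart_dom i `&` chart_dom j))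
      (chart_map j \o chart_inv i)
}.

Section Surface.
Context {R : realType} {M : topologicalType} (S : surface R M).

Definition chart_at (p : M) : chart S := projT1 (cid (chart_cover S p)).

Definition smooth_fun (U : set M) (f : M -> R) : Prop :=
  forall i : chart S, Cinfty (chart_map i @` (U `&` chart_dom i)) (f \o chart_inv i).

(* A tangent vector at p is a family of coordinate vectors, one for each chart
   around p, related by the differentials of the transition maps; the family is
   extended by 0 to the other charts so that equality of tangent vectors is
   equality of families.  T_pM is the subspace [tangent p] of the vector space
   [tvec]. *)
Definition tvec : Type := chart S -> 'rV[R]_2.

Definition tangent (p : M) : set tvec := [set v |
  (forall i, ~ chart_dom i p -> v i = 0) /\
  (forall i j, chart_dom i p -> chart_dom j p ->
    v j = 'd (chart_map j \o chart_inv i) (chart_map i p) (v i))].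

Definition smooth_field (U : set M) (X : M -> tvec) : Prop :=
  (forall p, U p -> tangent p (X p)) /\
  (forall i, Cinfty (chart_map i @` (U `&` chart_dom i)) (fun x => X (chart_inv i x) i)).

(* v(f), for v in T_pM and f smooth near p; independent of the chart. *)
Definition dirder (p : M) (v : tvec) (f : M -> R) : R :=
  let i := chart_at p in 'D_(v i) (f \o chart_inv i) (chart_map i p).

(* The coordinate field d/dx^k of the chart i. *)
Definition frame (i : chart S) (k : 'I_2) (p : M) : tvec := fun j =>
  if `[< chart_dom i p /\ chart_dom j p >]
  then 'd (chart_map j \o chart_inv i) (chart_map i p) (delta_mx 0 k) else 0.

(* An affine connection, acting on fields defined on open subsets of M:
   nabla p v Y is nabla_v Y in T_pM, for v in T_pM and Y a vector field that is
   smooth on a neighbourhood U of p. *)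
Record connection := Connection {
  nabla :> M -> tvec -> (M -> tvec) -> tvec;
  nabla_smooth : forall U X Y, open U -> smooth_field U X -> smooth_field U Y ->
    smooth_field U (fun p => nabla p (X p) Y);
  nabla_linear : forall U p a v w Y, open U -> U p -> smooth_field U Y ->
    tangent p v -> tangent p w ->
    nabla p (a *: v + w) Y = a *: nabla p v Y + nabla p w Y;
  nabla_add : forall U p v Y Z, open U -> U p ->
    smooth_field U Y -> smooth_field U Z -> tangent p v ->
    nabla p v (fun q => Y q + Z q) = nabla p v Y + nabla p v Z;
  nabla_leibniz : forall U p v f Y, open U -> U p ->
    smooth_fun U f -> smooth_field U Y -> tangent p v ->
    nabla p v (fun q => f q *: Y q) =
      dirder p v f *: Y p + f p *: nabla p v Y
}.

(* nabla_X Y - nabla_Y X = [X, Y], both sides acting on smooth functions. *)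
Definition torsion_free (D : connection) : Prop :=
  forall U X Y f p, open U -> U p ->
    smooth_field U X -> smooth_field U Y -> smooth_fun U f ->
    dirder p (D p (X p) Y - D p (Y p) X) f =
      dirder p (X p) (fun q => dirder q (Y q) f)
      - dirder p (Y p) (fun q => dirder q (X q) f).

Record volume_form := VolumeForm {
  volume :> M -> tvec -> tvec -> R;
  volume_linear : forall p a u v w, tangent p u -> tangent p v -> tangent p w ->
    volume p (a *: u + v) w = a * volume p u w + volume p v w;
  volume_antisymmetric : forall p v w, tangent p v -> tangent p w ->
    volume p v w = - volume p w v;
  volume_smooth : forall U X Y, open U -> smooth_field U X -> smooth_field U Y ->
    smooth_fun U (fun p => volume p (X p) (Y p));
  volume_neq0 : forall p, exists v w,
    [/\ tangent p v, tangent p w & volume p v w != 0]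
}.

Definition parallel (D : connection) (Om : volume_form) : Prop :=
  forall U X Y p v, open U -> U p ->
    smooth_field U X -> smooth_field U Y -> tangent p v ->
    dirder p v (fun q => Om q (X q) (Y q)) =
      Om p (D p v X) (Y p) + Om p (X p) (D p v Y).

Record equiaffine := Equiaffine {
  conn : connection;
  vol : volume_form;
  conn_torsion_free : torsion_free conn;
  vol_parallel : parallel conn vol
}.

End Surface.

Section Curve.
Context {R : realType} {M : topologicalType} (S : surface R M).

(* Curves are functions on R of which only the values on the open interval I
   matter. *)
Definition smooth_curve (I : set R) (alpha : R -> M) : Prop :=
  (forall t, I t -> {for t, continuous alpha}) /\
  (forall i : chart S,
    Cinfty (I `&` alpha @^-1` chart_dom i) (chart_map i \o alpha)).

Definition velocity (alpha : R -> M) (t : R) : tvec S := fun i =>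
  if `[< chart_dom i (alpha t) >] then derive1 (chart_map i \o alpha) t else 0.

(* Covariant differentiation of a vector field V along alpha: if
   V = \sum_k V^k d/dx^k in a chart around alpha t, then
   (nabla_{alpha'} V) (t) =
     \sum_k ((V^k)' (t) d/dx^k + V^k (t) nabla_{alpha' (t)} d/dx^k). *)
Definition covder (D : connection S) (alpha : R -> M) (V : R -> tvec S) (t : R) :
    tvec S :=
  let p := alpha t in
  let i := chart_at S p in
  \sum_(k < 2) (derive1 (fun s => V s i 0 k) t *: frame i k p
                + V t i 0 k *: D p (velocity alpha t) (frame i k)).

End Curve.

Section EquiaffineCurve.
Context {R : realType} {M : topologicalType} {S : surface R M}.
Variable A : equiaffine S.

Definition acceleration (alpha : R -> M) : R -> tvec S :=
  covder (conn A) alpha (velocity alpha).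

Definition jerk (alpha : R -> M) : R -> tvec S :=
  covder (conn A) alpha (acceleration alpha).

Definition nondegenerate_curve (I : set R) (alpha : R -> M) : Prop :=
  forall t, I t ->
    vol A (alpha t) (velocity alpha t) (acceleration alpha t) != 0.

Definition cbrt (x : R) : R := Num.sg x * (`|x| `^ (3%:R^-1)).

(* The integral of f from a to b, for a and b in either order. *)
Definition oriented_integral (f : R -> R) (a b : R) : R :=
  if a <= b then \int[lebesgue_measure]_(u in `[a, b]) f u
  else - \int[lebesgue_measure]_(u in `[b, a]) f u.

Definition arclength_speed (alpha : R -> M) (t : R) : R :=
  cbrt (vol A (alpha t) (velocity alpha t) (acceleration alpha t)).

Definition arclength (alpha : R -> M) (t0 t : R) : R :=
  oriented_integral (arclength_speed alpha) t0 t.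

(* alpha composed with the inverse of [arclength alpha t0 : I -> J]. *)
Definition arclength_reparam (I : set R) (alpha : R -> M) (t0 s : R) : M :=
  alpha (get [set t | I t /\ arclength alpha t0 t = s]).

(* The k such that nabla^2_{beta'} beta' = - k beta' at s. *)
Definition arclength_curvature (beta : R -> M) (s : R) : R :=
  get [set k | jerk beta s = - (k *: velocity beta s)].

Definition curvature (I : set R) (alpha : R -> M) (t0 t : R) : R :=
  arclength_curvature (arclength_reparam I alpha t0) (arclength alpha t0 t).

End EquiaffineCurve.

(* Main.v *)
Require Import Defs.
From HB Require Import structures.
From mathcomp Require Import all_boot all_order all_algebra.
From mathcomp Require Import all_classical all_reals all_analysis.
From mathcomp Require Import ring.

Set Implicit Arguments.
Unset Strict Implicit.
Unset Printing Implicit Defensive.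

Import Order.TTheory GRing.Theory Num.Theory.
Import numFieldNormedType.Exports.

Local Open Scope classical_set_scope.
Local Open Scope ring_scope.

(** Let v = alpha', a = nabla_{alpha'} v and j = nabla_{alpha'} a be the
    velocity, acceleration and jerk of alpha, and w = Omega(v, a), so that
    psi^3 = 1/w.  Write nabla for nabla_{alpha'} and put chi = psi psi'.

    The arclength sigma has derivative 1/psi, hence an inverse tau with
    tau' = psi(tau), and beta = alpha(tau) is the arclength reparametrization.
    Covariant differentiation along beta is psi times covariant differentiation
    along alpha ([covder_reparam]), so the product rule ([covder_comb]) gives,
    at corresponding parameters,
      beta'         = psi v,
      nabla beta'   = chi v + psi^2 a,
      nabla^2 beta' = psi (chi' v + 3 chi a + psi^2 j).
    Since Omega is parallel, w' = Omega(a, a) + Omega(v, j) = Omega(v, j)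
    ([is_derive_volume]), that is psi' = - (1/3) psi^4 Omega(v, j).  In a plane,
    w j = Omega(j, a) v + Omega(v, j) a ([volume_cramer]).  After substitution
    the coefficient of a in nabla^2 beta' vanishes, which is what makes the
    curvature exist, and there remains
      nabla^2 beta' = - (- chi' + psi^5 Omega(a, j)) beta',
    where chi' = (psi^2)''/2.

    Most of the work makes this computation legitimate.  The covariant
    derivative along a curve is computed at each t in a chart that depends on t,
    so that even the differentiability of the acceleration is not visible from
    its definition.  One needs that the same formula holds in every chart
    ([covder_chart]); this is the Leibniz rule applied to one coordinate frame
    expanded in another, and it rests on the locality of the connection
    ([nabla_local]) and on the smoothness of coordinate frames
    ([smooth_field_frame]).  With the chart fixed near t, the covariant
    derivative of a smooth field along alpha is again smooth
    ([smooth_along_covder]).  On the analytic side, sigma is differentiated by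
    the fundamental theorem of calculus, and sigma is injective by Rolle's
    theorem because its derivative never vanishes
    ([is_derive_oriented_integral], [is_derive_get_inverse]). *)

(** * Calculus of the classes C^n *)

(** The first order expansion of f at x only depends on the germ of f. *)
Lemma near_eq_differentiable (R : realType) (E W : normedModType R)
    (f g : E -> W) x :
  {near x, f =1 g} -> differentiable f x -> differentiable g x.
Proof.
move=> fg /diff_locallyP[dfc dfE].
have gE : g \o shift x = cst (g x) + 'd f x +o_ (0 : E) id.
  apply/eqaddoP => e e0.
  have /eqaddoP/(_ e e0) := dfE.
  have : \forall h \near (0 : E), f (h + x) = g (h + x).
    by rewrite (near_shift x)/=; near do rewrite /= sub0r addrNK.
  apply: filterS2 => h fgh; rewrite !fctE /=.
  by rewrite fgh (nbhs_singleton fg).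
have dgE : 'd g x = 'd f x :> (E -> W) by exact: diff_unique.
by apply/diff_locallyP; rewrite dgE.
Unshelve. all: by end_near. Qed.

Section Cn_calculus.
Context {R : realType} {E : normedModType R}.
Implicit Types (U : set E) (n : nat).

(** Openness of U is what makes the directional derivatives agree too. *)
Lemma Cn_ext {W : normedModType R} n U (f g : E -> W) :
  open U -> {in U, f =1 g} -> Cn n U f -> Cn n U g.
Proof.
move=> oU; have nearU (f1 g1 : E -> W) x : {in U, f1 =1 g1} -> U x ->
    {near x, f1 =1 g1}.
  move=> fg Ux; have : \forall y \near x, U y by exact: open_nbhs_nbhs.
  by apply: filterS => y Uy; apply: fg; rewrite inE.
elim: n f g => [|n IHn] f g fg /=.
  move=> fc x Ux; have fgx := nearU _ _ _ fg Ux.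
  change (g @ x --> g x); rewrite -(nbhs_singleton fgx).
  by apply: cvg_trans (fc x Ux); apply: near_eq_cvg.
case=> fd fD; split=> [x Ux|v].
  by apply: near_eq_differentiable (fd x Ux); exact: nearU.
apply: IHn (fD v) => x /set_mem Ux.
by apply: near_eq_derive; exact: nearU.
Qed.

Lemma Cn_sub {W : normedModType R} n U V (f : E -> W) :
  U `<=` V -> Cn n V f -> Cn n U f.
Proof.
move=> UV; elim: n f => [|n IHn] f /= fC; first by move=> x /UV; exact: fC.
by split=> [x /UV|v]; [exact: fC.1|exact/IHn/fC.2].
Qed.

Lemma CnS {W : normedModType R} n U (f : E -> W) : Cn n.+1 U f -> Cn n U f.
Proof.
elim: n f => [|n IHn] f [fd fD] /=.
  by move=> x Ux; apply: differentiable_continuous; exact: fd.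
by split=> // v; apply: IHn; exact: fD.
Qed.

Lemma Cn_cst {W : normedModType R} n U (w : W) : Cn n U (cst w).
Proof.
elim: n w => [|n IHn] w /=; first by move=> x _; exact: cvg_cst.
split=> [x _|v]; first exact: differentiable_cst.
by rewrite (_ : 'D_v _ = cst 0) //; apply/funext => x; exact: derive_cst.
Qed.

Lemma Cn_add {W : normedModType R} n U (f g : E -> W) : open U ->
  Cn n U f -> Cn n U g -> Cn n U (fun x => f x + g x).
Proof.
move=> oU; elim: n f g => [|n IHn] f g /=.
  by move=> fc gc x Ux; apply: cvgD; [exact: fc|exact: gc].
move=> [fd fD] [gd gD]; split=> [x Ux|v].
  by apply: differentiableD; [exact: fd|exact: gd].
apply: Cn_ext (IHn _ _ (fD v) (gD v)) => // x /set_mem Ux.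
by rewrite deriveD //; apply: diff_derivable; [exact: fd|exact: gd].
Qed.

Lemma Cn_sum {W : normedModType R} n U m (f : 'I_m -> E -> W) : open U ->
  (forall i, Cn n U (f i)) -> Cn n U (fun x => \sum_i f i x).
Proof.
move=> oU fC; elim: m f fC => [|m IHm] f fC.
  apply: Cn_ext (Cn_cst n U 0) => // x _.
  by rewrite big_ord0.
have := Cn_add oU (fC ord0) (IHm (fun i => f (lift ord0 i)) (fun i => fC _)).
by apply: Cn_ext => // x _; rewrite big_ord_recl.
Qed.

Lemma Cn_mul n U (f g : E -> R) : open U ->
  Cn n U f -> Cn n U g -> Cn n U (fun x => f x * g x).
Proof.
move=> oU; elim: n f g => [|n IHn] f g /=.
  by move=> fc gc x Ux; apply: cvgM; [exact: fc|exact: gc].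
move=> fC gC; have [fd fD] := fC; have [gd gD] := gC; split=> [x Ux|v].
  by apply: differentiableM; [exact: fd|exact: gd].
have := Cn_add oU (IHn _ _ (CnS fC) (gD v))
  (IHn _ _ (CnS gC) (fD v)).
apply: Cn_ext => // x /set_mem Ux.
by rewrite deriveM //; apply: diff_derivable; [exact: fd|exact: gd].
Qed.

Lemma derivable_coord m (f : E -> 'rV[R]_m) x v k :
  derivable f x v -> derivable (fun y => f y 0 k) x v.
Proof. by move=> /derivable_mxP. Qed.

Lemma derive_coord m (f : E -> 'rV[R]_m) x v k :
  derivable f x v -> 'D_v (fun y => f y 0 k) x = 'D_v f x 0 k.
Proof. by move=> fd; rewrite (derive_mx fd) mxE. Qed.

(** Reduces the calculus of vector-valued maps to that of scalar ones, for
    which the product rule is available. *)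
Lemma Cn_coord n U m (f : E -> 'rV[R]_m) : open U ->
  Cn n U f <-> forall k, Cn n U (fun x => f x 0 k).
Proof.
move=> oU; split.
  move=> + k; elim: n f => [|n IHn] f /=.
    move=> fc x Ux.
    apply: (@continuous_comp _ _ _ f (fun M : 'rV[R]_m => M 0 k)) (fc x Ux) _.
    exact: coord_continuous.
  case=> fd fD; split=> [x Ux|v].
    apply: (@differentiable_comp _ _ _ _ f (fun M : 'rV[R]_m => M 0 k)).
      exact: fd.
    exact: differentiable_coord.
  apply: Cn_ext (IHn _ (fD v)) => // x /set_mem Ux.
  by rewrite derive_coord//; apply: diff_derivable; exact: fd.
have sumE (g : E -> 'rV[R]_m) : g = (fun x => \sum_k g x 0 k *: delta_mx 0 k).
  by apply/funext => x; exact: row_sum_delta.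
elim: n f => [|n IHn] f /= fC.
  rewrite (sumE f); apply: (@Cn_sum _ 0) => // k x Ux.
  by apply: cvgZr_tmp; exact: fC.
have fd x : U x -> differentiable f x.
  rewrite (sumE f) => Ux.
  have -> : (fun x => \sum_k f x 0 k *: delta_mx 0 k) =
     \sum_k (fun x => f x 0 k *: delta_mx 0 k) :> (E -> 'rV[R]_m).
    by apply/funext => y; rewrite fct_sumE.
  apply: differentiable_sum => k; apply: differentiableZl.
  exact: (fC k).1.
split=> // v; apply: IHn => k.
apply: Cn_ext ((fC k).2 v) => // x /set_mem Ux.
by rewrite derive_coord//; apply: diff_derivable; exact: fd.
Qed.

Lemma derive_comp {F W : normedModType R} (f : E -> F) (g : F -> W) x v :
  differentiable f x -> differentiable g (f x) ->
  'D_v (g \o f) x = 'D_('D_v f x) g (f x).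
Proof.
move=> fd gd; rewrite (deriveE _ (differentiable_comp fd gd)) diff_comp//=.
by rewrite -(deriveE _ fd) -(deriveE _ gd).
Qed.

(** The chain rule in partial derivatives: in this form the derivative of a
    composite is a sum of products of functions of class one less, which drives
    the induction in [Cn_comp_scalar]. *)
Lemma derive_comp_row m {W : normedModType R} (f : E -> 'rV[R]_m)
    (g : 'rV[R]_m -> W) x v :
  differentiable f x -> differentiable g (f x) ->
  'D_v (g \o f) x = \sum_k 'D_v f x 0 k *: 'D_(delta_mx 0 k) g (f x).
Proof.
move=> fd gd; rewrite derive_comp// (deriveE _ gd).
rewrite {1}(row_sum_delta ('D_v f x)) linear_sum.
by apply: eq_bigr => k _; rewrite linearZ /= (deriveE _ gd).
Qed.

Lemma Cn_comp_scalar n m U (V : set 'rV[R]_m) (f : E -> 'rV[R]_m)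
    (g : 'rV[R]_m -> R) :
  open U -> (forall x, U x -> V (f x)) ->
  Cn n U f -> Cn n V g -> Cn n U (g \o f).
Proof.
move=> oU UV; elim: n g => [|n IHn] g /=.
  by move=> fc gc x Ux; apply: continuous_comp; [exact: fc|exact/gc/UV].
move=> fC gC; have [fd fD] := fC; have [gd gD] := gC; split=> [x Ux|v].
  by apply: differentiable_comp; [exact: fd|exact/gd/UV].
have dfk k : Cn n U (fun x => 'D_v f x 0 k).
  by exact: ((Cn_coord _ _ oU).1 (fD v) k).
have dgk k : Cn n U (fun x => 'D_(delta_mx 0 k) g (f x)).
  by apply: (IHn ('D_(delta_mx 0 k) g)); [exact: CnS|exact: gD].
have := Cn_sum oU (fun k => Cn_mul oU (dfk k) (dgk k)).
apply: Cn_ext => // x /set_mem Ux.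
by rewrite derive_comp_row//; [exact: fd|exact/gd/UV].
Qed.

End Cn_calculus.

Lemma Cn_comp {R : realType} {E : normedModType R} n m p (U : set E)
    (V : set 'rV[R]_m) (f : E -> 'rV[R]_m) (g : 'rV[R]_m -> 'rV[R]_p) :
  open U -> open V -> (forall x, U x -> V (f x)) ->
  Cn n U f -> Cn n V g -> Cn n U (g \o f).
Proof.
move=> oU oV UV fC gC; apply/(Cn_coord _ _ oU) => k.
apply: (@Cn_comp_scalar _ _ _ _ _ V f (fun y => g y 0 k)) => //.
exact: ((Cn_coord _ _ oV).1 gC k).
Qed.

Lemma is_derive_sum_mul {R : realType} {E : normedModType R} n
    (f g : 'I_n -> E -> R) (df dg : 'I_n -> R) (x v : E) :
  (forall l, is_derive x v (f l) (df l)) ->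
  (forall l, is_derive x v (g l) (dg l)) ->
  is_derive x v (fun y => \sum_l f l y * g l y)
    (\sum_l (df l * g l x + f l x * dg l)).
Proof.
move=> fd gd.
have -> : (fun y => \sum_l f l y * g l y) = \sum_l (f l * g l) :> (E -> R).
  by apply/funext => y; rewrite fct_sumE.
apply: is_derive_eq; apply: eq_bigr => l _.
by rewrite addrC [g l x *: _]mulrC.
Qed.

Lemma derive_comp_real {R : realType} {E W : normedModType R}
    (tau : E -> R) (f : R -> W) (x v : E) :
  differentiable tau x -> differentiable f (tau x) ->
  'D_v (f \o tau) x = 'D_v tau x *: 'D_1 f (tau x).
Proof.
move=> dtau df; rewrite derive_comp// !(deriveE _ df).
by rewrite -[X in 'd f _ X]mulr1 [LHS]linearZ.
Qed.

(** * Charts and transition maps *)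

Section SurfaceCalculus.
Context {R : realType} {M : topologicalType} {S : surface R M}.
Implicit Types (U : set M) (i j : chart S) (p q : M) (v w : tvec S).

(** The image is the part of the open set chart_map i @` chart_dom i on which the
    continuous map chart_inv i takes values in U. *)
Lemma chart_image_setI_open i U :
  open U -> open (chart_map i @` (U `&` chart_dom i)).
Proof.
move=> oU; rewrite openE => _ [p [Up ip] <-].
have imx : (chart_map i @` chart_dom i) (chart_map i p) by exists p.
have oim := @chart_image_open _ _ S i.
have near_im : \forall x \near chart_map i p, (chart_map i @` chart_dom i) x.
  exact: open_nbhs_nbhs.
have near_U : \forall x \near chart_map i p, U (chart_inv i x).
  apply: (chart_inv_continuous imx).
  by rewrite /= chart_mapK//; apply: open_nbhs_nbhs.
rewrite /interior; apply: filterS2 near_im near_U => x [q iq <-].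
by rewrite chart_mapK// => Uq; exists q.
Qed.

Lemma near_chart i U p : open U -> U p -> chart_dom i p ->
  \forall x \near chart_map i p, (chart_map i @` (U `&` chart_dom i)) x.
Proof.
move=> oU Up ip; apply: open_nbhs_nbhs; split; last by exists p.
exact: chart_image_setI_open.
Qed.

Lemma transition_differentiable i j p : chart_dom i p -> chart_dom j p ->
  differentiable (chart_map j \o chart_inv i) (chart_map i p).
Proof. by move=> ip jp; apply: (transition_smooth i j 1).1; exists p. Qed.

(** Near chart_map i p the transition maps compose, and the chain rule applies. *)
Lemma transition_diff_comp i j (k : chart S) p u :
  chart_dom i p -> chart_dom j p -> chart_dom k p ->
  'd (chart_map k \o chart_inv j) (chart_map j p)
    ('d (chart_map j \o chart_inv i) (chart_map i p) u) =
  'd (chart_map k \o chart_inv i) (chart_map i p) u.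
Proof.
move=> ip jp kp.
have dij := transition_differentiable ip jp.
have djk := transition_differentiable jp kp.
have dik := transition_differentiable ip kp.
rewrite -[RHS]deriveE//.
have -> : 'D_u (chart_map k \o chart_inv i) (chart_map i p) =
    'D_u ((chart_map k \o chart_inv j) \o (chart_map j \o chart_inv i))
      (chart_map i p).
  apply: near_eq_derive.
  apply: filterS (near_chart (chart_open j) jp ip) => _ [q [jq iq] <-] /=.
  by rewrite (chart_mapK iq) (chart_mapK jq).
set F := chart_map j \o chart_inv i; set G := chart_map k \o chart_inv j.
have FE : F (chart_map i p) = chart_map j p by rewrite /F /= chart_mapK.
have dG : differentiable G (F (chart_map i p)) by rewrite FE.
have /= := @derive_comp _ _ _ _ F G _ u dij dG.
by rewrite FE (deriveE _ dij) (deriveE _ djk) => ->.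
Qed.

Lemma transition_diff_id i p u : chart_dom i p ->
  'd (chart_map i \o chart_inv i) (chart_map i p) u = u.
Proof.
move=> ip; rewrite -deriveE; last exact: transition_differentiable.
rewrite (@near_eq_derive _ _ _ _ id) ?derive_id//.
apply: filterS (near_chart openT (I : [set: M] p) ip) => _ [q [_ iq] <-] /=.
by rewrite chart_mapK.
Qed.

(** * Tangent vectors *)

(** The compatibility condition transports the coordinates in the chart i to
    every other chart around p, and they vanish in the charts away from p. *)
Lemma tangent_eq i p v w : chart_dom i p -> tangent p v -> tangent p w ->
  v i = w i -> v = w.
Proof.
move=> ip [v0 vE] [w0 wE] vw; apply/funext => j.
have [jp|njp] := pselect (chart_dom j p).
  by rewrite (vE i)// (wE i)// vw.
by rewrite v0// w0.
Qed.

Lemma tangent_lin p a v w :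
  tangent p v -> tangent p w -> tangent p (a *: v + w).
Proof.
move=> [v0 vE] [w0 wE]; split=> [i ip|i j ip jp].
  by rewrite !fctE v0// w0// scaler0 addr0.
by rewrite !fctE (vE i)// (wE i)// linearP.
Qed.

Lemma tangent0 p : tangent p (0 : tvec S).
Proof. by split=> // i j ip jp; rewrite !fctE linear0. Qed.

Lemma tangentZ p a v : tangent p v -> tangent p (a *: v).
Proof.
by move=> vp; rewrite -[_ *: _]addr0; apply: tangent_lin => //; exact: tangent0.
Qed.

Lemma tangentD p v w : tangent p v -> tangent p w -> tangent p (v + w).
Proof. by move=> vp wp; rewrite -[v]scale1r; exact: tangent_lin. Qed.

Lemma tangent_sum p n (v : 'I_n -> tvec S) :
  (forall k, tangent p (v k)) -> tangent p (\sum_k v k).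
Proof.
move=> vp; elim/big_ind : _ => //; [exact: tangent0|].
by move=> *; exact: tangentD.
Qed.

Lemma frameE i k p j : chart_dom i p -> chart_dom j p ->
  frame i k p j = 'd (chart_map j \o chart_inv i) (chart_map i p) (delta_mx 0 k).
Proof. by move=> ip jp; rewrite /frame asboolT. Qed.

Lemma tangent_frame i k p : chart_dom i p -> tangent p (frame i k p).
Proof.
move=> ip; split=> [j jp|j l jp lp]; first by rewrite /frame asboolF// => -[].
rewrite (frameE _ ip lp) (frameE _ ip jp).
exact: (esym (transition_diff_comp _ ip jp lp)).
Qed.

Lemma tangent_coord i p v : chart_dom i p -> tangent p v ->
  v = \sum_k v i 0 k *: frame i k p.
Proof.
move=> ip vp; apply: (tangent_eq ip vp).
  by apply: tangent_sum => k; apply/tangentZ/tangent_frame.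
rewrite fct_sumE {1}[v i]row_sum_delta; apply: eq_bigr => k _.
by rewrite !fctE (frameE _ ip ip) (transition_diff_id _ ip).
Qed.

Lemma tangent_coord2 i p v : chart_dom i p -> tangent p v ->
  v = v i 0 0 *: frame i 0 p + v i 0 1 *: frame i 1 p.
Proof.
move=> ip vp; rewrite {1}(tangent_coord ip vp) !big_ord_recl big_ord0 addr0.
by congr (_ + v i 0 _ *: frame i _ p); apply/val_inj.
Qed.

(** * Smooth functions and vector fields *)

(** Composition with a smooth transition map; hence regularity on a set may be
    checked in a single chart around it. *)
Lemma Cn_change_chart n i j U m (f : M -> 'rV[R]_m) : open U ->
  Cn n (chart_map i @` (U `&` chart_dom i)) (f \o chart_inv i) ->
  Cn n (chart_map j @` ((U `&` chart_dom i) `&` chart_dom j)) (f \o chart_inv j).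
Proof.
move=> oU fC; have oUi := openI oU (chart_open i).
have oUij := chart_image_setI_open (i := j) oUi.
have Cji : Cn n (chart_map j @` ((U `&` chart_dom i) `&` chart_dom j))
    (chart_map i \o chart_inv j).
  apply: Cn_sub (transition_smooth j i n) => _ [q [[_ iq] jq] <-].
  by exists q.
have := Cn_comp oUij (chart_image_setI_open (i := i) oU) _ Cji fC.
have im x : (chart_map j @` (U `&` chart_dom i `&` chart_dom j)) x ->
  (chart_map i @` (U `&` chart_dom i)) ((chart_map i \o chart_inv j) x).
  by move=> [q [[Uq iq] jq] <-]; exists q => //=; rewrite chart_mapK.
move=> /(_ im); apply: Cn_ext => // x /set_mem[q [[Uq iq] jq] <-] /=.
by rewrite (chart_mapK jq) (chart_mapK iq).
Qed.

Lemma smooth_field_sub U V (X : M -> tvec S) :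
  U `<=` V -> smooth_field V X -> smooth_field U X.
Proof.
move=> UV [Xt XC]; split=> [p /UV/Xt//|i n].
by apply: Cn_sub (XC i n) => _ [q [/UV Vq iq] <-]; exists q.
Qed.

(** The coordinates in the chart j of the frame of the chart i are partial
    derivatives of a transition map; they are seen to be smooth in the chart i. *)
Lemma smooth_field_frame i k : smooth_field (chart_dom i) (frame i k).
Proof.
split=> [p ip|j n]; first exact: tangent_frame.
have fC : Cn n (chart_map i @` (chart_dom j `&` chart_dom i))
    ((fun q => frame i k q j) \o chart_inv i).
  have tC := (transition_smooth i j n.+1).2 (delta_mx 0 k).
  rewrite setIC; apply: Cn_ext tC; rewrite setIC.
    exact/chart_image_setI_open/chart_open.
  move=> x /set_mem[q [jq iq] <-] /=.
  by rewrite (chart_mapK iq) (frameE _ iq jq)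
    (deriveE _ (transition_differentiable iq jq)).
have := Cn_change_chart j (chart_open j) fC.
by apply: Cn_sub => _ [q [iq jq] <-]; exists q.
Qed.

Lemma smooth_field_coord U (X : M -> tvec S) i k : open U ->
  smooth_field U X -> smooth_fun S (U `&` chart_dom i) (fun q => X q i 0 k).
Proof.
move=> oU [_ XC] j n.
have oUij := chart_image_setI_open (i := j) (openI oU (chart_open i)).
have := Cn_change_chart (f := fun q => X q i) j oU (XC i n).
by move=> fC; exact: ((Cn_coord _ _ oUij).1 fC k).
Qed.

Lemma smooth_fieldZ U f (X : M -> tvec S) : open U -> smooth_fun S U f ->
  smooth_field U X -> smooth_field U (fun q => f q *: X q).
Proof.
move=> oU fC [Xt XC]; split=> [p Up|i n]; first exact/tangentZ/Xt.
have oUi := chart_image_setI_open (i := i) oU.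
apply/(Cn_coord _ _ oUi) => k.
have := Cn_mul oUi (fC i n) ((Cn_coord _ _ oUi).1 (XC i n) k).
by apply: Cn_ext => // x _; rewrite !fctE mxE.
Qed.

Lemma smooth_fieldD U (X Y : M -> tvec S) : open U ->
  smooth_field U X -> smooth_field U Y -> smooth_field U (fun q => X q + Y q).
Proof.
move=> oU [Xt XC] [Yt YC]; split=> [p Up|i n].
  by apply: tangentD; [exact: Xt|exact: Yt].
exact: Cn_add (chart_image_setI_open (i := i) oU) (XC i n) (YC i n).
Qed.

Lemma smooth_fun_cst U (c : R) : smooth_fun S U (cst c).
Proof. by move=> i n; exact: (Cn_cst n _ c). Qed.

Lemma smooth_fun_ext U f g : open U -> {in U, f =1 g} ->
  smooth_fun S U f -> smooth_fun S U g.
Proof.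
move=> oU fg fC i n; apply: Cn_ext (fC i n); first exact: chart_image_setI_open.
by move=> x /set_mem[q [Uq iq] <-] /=; rewrite chart_mapK// fg// inE.
Qed.

Lemma smooth_field_ext U (X Y : M -> tvec S) : open U -> {in U, X =1 Y} ->
  smooth_field U X -> smooth_field U Y.
Proof.
move=> oU XY [Xt XC]; split=> [p Up|i n]; first by rewrite -XY ?inE//; exact: Xt.
apply: Cn_ext (XC i n); first exact: chart_image_setI_open.
by move=> x /set_mem[q [Uq iq] <-] /=; rewrite chart_mapK// XY// inE.
Qed.

Lemma smooth_field0 U : open U -> smooth_field U (fun=> 0 : tvec S).
Proof.
move=> oU; split=> [p _|i n]; first exact: tangent0.
exact: (Cn_cst n _ (0 : 'rV[R]_2)).
Qed.

(** Constant coordinates in a chart extend a tangent vector to a smooth field;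
    this transfers what is known of a connection on fields to single vectors. *)
Lemma smooth_field_extend i p v : chart_dom i p -> tangent p v ->
  exists X, smooth_field (chart_dom i) X /\ X p = v.
Proof.
move=> ip vp.
exists (fun q => v i 0 0 *: frame i 0 q + v i 0 1 *: frame i 1 q); split.
  have oi := chart_open i.
  apply: smooth_fieldD => //; apply: (@smooth_fieldZ _ (cst _)) => //;
    by [exact: smooth_fun_cst|exact: smooth_field_frame].
exact: (esym (tangent_coord2 ip vp)).
Qed.

(** * Affine connections *)
Variable D : connection S.

Lemma nabla_tangent U p v Y : open U -> U p -> smooth_field U Y ->
  tangent p v -> tangent p (D p v Y).
Proof.
move=> oU Up YC vp; have [i ip] := chart_cover S p.
have [X [XC Xp]] := smooth_field_extend ip vp.
have oUi := openI oU (chart_open i).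
have := nabla_smooth D oUi (smooth_field_sub (@subIsetr _ _ _) XC)
  (smooth_field_sub (@subIsetl _ _ _) YC).
by case=> /(_ p (conj Up ip)); rewrite Xp.
Qed.

Lemma nabla0 U p Y : open U -> U p -> smooth_field U Y -> D p 0 Y = 0.
Proof.
move=> oU Up YC.
have := nabla_linear D 1 oU Up YC (tangent0 p) (tangent0 p).
by rewrite scale1r addr0 => /eqP; rewrite -subr_eq subrr scale1r => /eqP.
Qed.

Lemma nablaZ U p a v Y : open U -> U p -> smooth_field U Y -> tangent p v ->
  D p (a *: v) Y = a *: D p v Y.
Proof.
move=> oU Up YC vp; have := nabla_linear D a oU Up YC vp (tangent0 p).
by rewrite addr0 (nabla0 oU Up YC) addr0.
Qed.

Lemma nablaDv U p v w Y : open U -> U p -> smooth_field U Y -> tangent p v ->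
  tangent p w -> D p (v + w) Y = D p v Y + D p w Y.
Proof.
move=> oU Up YC vp wp; have := nabla_linear D 1 oU Up YC vp wp.
by rewrite !scale1r.
Qed.

Lemma nabla_sumv U p n (v : 'I_n -> tvec S) Y :
  open U -> U p -> smooth_field U Y -> (forall k, tangent p (v k)) ->
  D p (\sum_k v k) Y = \sum_k D p (v k) Y.
Proof.
move=> oU Up YC; elim: n v => [|n IHn] v vp.
  by rewrite !big_ord0 (nabla0 oU Up YC).
rewrite !big_ord_recl (nablaDv oU Up YC) ?IHn//.
exact: tangent_sum.
Qed.

(** A step function plays the part of a bump function: W = Y - Z vanishes on U,
    so W = f W everywhere for the function f equal to 0 on U and to 1 elsewhere.
    This f is smooth on the open set U, and the Leibniz rule at a point of U
    gives nabla W = 0. *)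
Lemma nabla_local U p v Y Z : open U -> U p -> smooth_field U Y ->
  smooth_field U Z -> {in U, Y =1 Z} -> tangent p v -> D p v Y = D p v Z.
Proof.
move=> oU Up YC ZC YZ vp.
pose W q := Y q - Z q.
have W0 : {in U, (fun=> 0 : tvec S) =1 W} by move=> q Uq; rewrite /W YZ// subrr.
have WC : smooth_field U W := smooth_field_ext oU W0 (smooth_field0 oU).
pose f q : R := if `[< U q >] then 0 else 1.
have f0 : {in U, cst 0 =1 f} by move=> q /set_mem Uq; rewrite /f asboolT.
have fC : smooth_fun S U f := smooth_fun_ext oU f0 (smooth_fun_cst U 0).
have fW : (fun q => f q *: W q) = W.
  apply/funext => q; have [Uq|nUq] := pselect (U q).
    by rewrite -W0 ?inE// scaler0.
  by rewrite /f asboolF// scale1r.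
have nW : D p v W = 0.
  rewrite -fW (nabla_leibniz D oU Up fC WC vp).
  by rewrite -W0 ?inE// -f0 ?inE// scaler0 scale0r addr0.
have -> : Y = fun q => W q + Z q by apply/funext => q; rewrite /W subrK.
by rewrite (nabla_add D oU Up WC ZC vp) nW add0r.
Qed.

Lemma nabla_sum U p v n (f : 'I_n -> M -> R) (Y : 'I_n -> M -> tvec S) :
  open U -> U p -> tangent p v ->
  (forall k, smooth_fun S U (f k)) -> (forall k, smooth_field U (Y k)) ->
  smooth_field U (fun q => \sum_k f k q *: Y k q) /\
  D p v (fun q => \sum_k f k q *: Y k q) =
    \sum_k (dirder p v (f k) *: Y k p + f k p *: D p v (Y k)).
Proof.
move=> oU Up vp; elim: n f Y => [|n IHn] f Y fC YC.
  have -> : (fun q => \sum_(k < 0) f k q *: Y k q) = (fun=> 0).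
    by apply/funext => q; rewrite big_ord0.
  split; first exact: smooth_field0.
  have W0 := smooth_field0 oU.
  have zE : (fun=> 0 : tvec S) = fun q : M => cst (0 : R) q *: (0 : tvec S).
    by apply/funext => q; rewrite scaler0.
  rewrite zE (nabla_leibniz D oU Up (smooth_fun_cst U 0) W0 vp).
  by rewrite big_ord0 scaler0 scale0r addr0.
have [sC sE] := IHn (fun k => f (lift ord0 k)) (fun k => Y (lift ord0 k))
  (fun k => fC _) (fun k => YC _).
have hC := smooth_fieldZ oU (fC ord0) (YC ord0).
have -> : (fun q => \sum_(k < n.+1) f k q *: Y k q) = fun q =>
   f ord0 q *: Y ord0 q + \sum_(k < n) f (lift ord0 k) q *: Y (lift ord0 k) q.
  by apply/funext => q; rewrite big_ord_recl.
split; first exact: smooth_fieldD.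
rewrite (nabla_add D oU Up hC sC vp) sE big_ord_recl; congr (_ + _).
exact: (nabla_leibniz D oU Up (fC ord0) (YC ord0) vp).
Qed.

End SurfaceCalculus.

(** * Vector fields along a curve *)

Section AlongCurve.
Context {R : realType} {M : topologicalType} {S : surface R M}.
Variables (I : set R) (alpha : R -> M).
Hypotheses (I_open : open I) (alpha_smooth : smooth_curve S I alpha).
Implicit Types (U : set M) (i j : chart S) (p q : M) (s t : R)
  (V W : R -> tvec S).

Lemma near_curve U t : open U -> I t -> U (alpha t) ->
  \forall s \near t, I s /\ U (alpha s).
Proof.
move=> oU It Ut; apply: filterI; first exact: open_nbhs_nbhs.
by apply: (alpha_smooth.1 t It); exact: open_nbhs_nbhs.
Qed.

Lemma open_curve_preimage U : open U -> open (I `&` alpha @^-1` U).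
Proof. by move=> oU; rewrite openE => t [It Ut]; exact: near_curve. Qed.

Lemma chart_curve_differentiable i t : I t -> chart_dom i (alpha t) ->
  differentiable (chart_map i \o alpha) t.
Proof. by move=> It it; exact: (alpha_smooth.2 i 1 : _ /\ _).1. Qed.

Lemma velocityE i t : chart_dom i (alpha t) ->
  velocity alpha t i = 'D_1 (chart_map i \o alpha) t.
Proof.
move=> it; rewrite /velocity (asboolT it).
exact: (derive1E (chart_map i \o alpha) t).
Qed.

Lemma tangent_velocity t : I t -> tangent (alpha t) (velocity alpha t : tvec S).
Proof.
move=> It; split=> [i it|i j it jt]; first by rewrite /velocity asboolF.
rewrite (velocityE it) (velocityE jt).
set X := chart_map i \o alpha; set F := chart_map j \o chart_inv i.
have dX : differentiable X t := chart_curve_differentiable It it.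
have dF : differentiable F (X t) := transition_differentiable it jt.
rewrite -(deriveE _ dF) -(derive_comp _ dX dF); apply: near_eq_derive.
apply: filterS (near_curve (chart_open i) It it) => s [_ is_].
by rewrite /F /X /= chart_mapK.
Qed.

(** Chain rule in the chart that defines the directional derivative at the
    point alpha t. *)
Lemma is_derive_curve U f t : open U -> smooth_fun S U f -> I t ->
  U (alpha t) ->
  is_derive t 1 (f \o alpha) (dirder (S := S) (alpha t) (velocity alpha t) f).
Proof.
move=> oU fC It Ut; rewrite /dirder; set p := alpha t; set i := chart_at S p.
have ip : chart_dom i p by rewrite /i /chart_at; case: cid.
set X := chart_map i \o alpha; set F := f \o chart_inv i.
have dX : differentiable X t := chart_curve_differentiable It ip.
have dF : differentiable F (X t) by apply: (fC i 1%N).1; exists p.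
apply: (@near_eq_is_derive _ _ _ (F \o X)).
  apply: filterS (near_curve (chart_open i) It ip) => s [_ is_].
  by rewrite /F /X /= chart_mapK.
apply: DeriveDef; first exact/diff_derivable/differentiable_comp.
by rewrite (derive_comp _ dX dF) (velocityE ip).
Qed.

Definition smooth_along V :=
  (forall t, I t -> tangent (alpha t) (V t)) /\
  (forall i, Cinfty (I `&` alpha @^-1` chart_dom i) (fun t => V t i)).

Lemma smooth_along_velocity : smooth_along (velocity alpha).
Proof.
split=> [t|i n]; first exact: tangent_velocity.
apply: Cn_ext ((alpha_smooth.2 i n.+1 : _ /\ _).2 1).
  exact/open_curve_preimage/chart_open.
by move=> t /set_mem[_ it]; rewrite (velocityE it).
Qed.

Lemma Cn_field_curve i n (X : M -> tvec S) : smooth_field (chart_dom i) X ->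
  Cn n (I `&` alpha @^-1` chart_dom i) (fun t => X (alpha t) i).
Proof.
move=> [_ XC]; have oJ := open_curve_preimage (chart_open i).
have oi := chart_image_setI_open (i := i) (chart_open i).
have im t : (I `&` alpha @^-1` chart_dom i) t ->
    (chart_map i @` (chart_dom i `&` chart_dom i)) ((chart_map i \o alpha) t).
  by move=> [_ it]; exists (alpha t).
have := Cn_comp oJ oi im (alpha_smooth.2 i n) (XC i n).
by apply: Cn_ext => // t /set_mem[_ it] /=; rewrite chart_mapK.
Qed.

(** First order differentiability only: the fields psi v and
    chi v + psi^2 a to be differentiated have coefficients that involve a cube
    root, and one derivative at a time suffices. *)
Definition derivable_along V t := forall i k,
  chart_dom i (alpha t) -> derivable (fun s => V s i 0 k) t 1.

Lemma smooth_derivable_along V t : smooth_along V -> I t -> derivable_along V t.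
Proof.
move=> [_ VC] It i k it; apply/derivable_coord/diff_derivable.
exact: (VC i 1%N : _ /\ _).1.
Qed.

(** * Covariant differentiation along the curve *)
Variable D : connection S.

(** The covariant derivative may be computed from any expansion of V in smooth
    fields E l, not only in a coordinate frame.  Writing E l in the frame of the
    chart used by the definition, with coefficients c l k, both sides are equal
    by the product rule for f l * c l k on the left, and by the Leibniz rule for
    c l k times the frame on the right. *)
Lemma covder_fields V U (f : 'I_2 -> R -> R) (E : 'I_2 -> M -> tvec S) t :
  open U -> I t -> U (alpha t) -> (forall l, smooth_field U (E l)) ->
  (forall l, derivable (f l) t 1) ->
  (\forall s \near t, V s = \sum_l f l s *: E l (alpha s)) ->
  covder D alpha V t =
    \sum_l ('D_1 (f l) t *: E l (alpha t)
            + f l t *: D (alpha t) (velocity alpha t) (E l)).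
Proof.
move=> oU It Ut EC fd VE; have vp := tangent_velocity It.
rewrite /covder; set p := alpha t in Ut vp *; set i := chart_at S p.
have ip : chart_dom i p by rewrite /i /chart_at; case: cid.
set v := velocity alpha t in vp *.
have oUi := openI oU (chart_open i).
pose c l k q := E l q i 0 k.
have cC l k : smooth_fun S (U `&` chart_dom i) (c l k).
  exact: smooth_field_coord.
have FC k : smooth_field (U `&` chart_dom i) (frame i k).
  by apply: smooth_field_sub (smooth_field_frame i k) => q [].
have EE l q : U q -> chart_dom i q -> E l q = \sum_k c l k q *: frame i k q.
  by move=> Uq iq; exact/tangent_coord/((EC l).1).
have nablaE l : D p v (E l) =
    \sum_k (dirder p v (c l k) *: frame i k p + c l k p *: D p v (frame i k)).
  have [sC <-] := nabla_sum D oUi (conj Ut ip) vp (cC l) FC.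
  apply: (nabla_local D oUi (conj Ut ip) _ sC _ vp).
    by apply: smooth_field_sub (EC l) => q [].
  by move=> q /set_mem[Uq iq]; exact: EE.
(* The product rule, where the derivative of c l k along alpha is v(c l k). *)
have VkE k : derive1 (fun s => V s i 0 k) t =
    \sum_l ('D_1 (f l) t * c l k p + f l t * dirder p v (c l k)).
  have VkD : is_derive t 1 (fun s => V s i 0 k)
      (\sum_l ('D_1 (f l) t * c l k p + f l t * dirder p v (c l k))).
    apply: (@near_eq_is_derive _ _ _ (fun s => \sum_l f l s * c l k (alpha s))).
      apply: filterS2 VE (near_curve oUi It (conj Ut ip)) => s -> _.
      by rewrite fct_sumE summxE; apply: eq_bigr => l _; rewrite !fctE mxE.
    apply: (is_derive_sum_mul (f := f) (g := fun l => c l k \o alpha)) => l.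
      exact: derivableP.
    exact: (is_derive_curve oUi (cC l k) It (conj Ut ip)).
  have -> : derive1 (fun s => V s i 0 k) t = 'D_1 (fun s => V s i 0 k) t.
    exact: derive1E.
  exact: derive_val.
have Vt k : V t i 0 k = \sum_l f l t * c l k p.
  rewrite (nbhs_singleton VE) fct_sumE summxE.
  by apply: eq_bigr => l _; rewrite !fctE mxE.
under eq_bigr => k _ do rewrite VkE Vt !scaler_suml -big_split.
rewrite exchange_big; apply: eq_bigr => l _.
rewrite nablaE [in RHS](EE l p Ut ip) !scaler_sumr -big_split.
apply: eq_bigr => k _ /=.
by rewrite scalerDl scalerDr !scalerA addrA.
Qed.

(** Independence of the chart: [covder_fields] for the coordinate frame of i. *)
Lemma covder_chart V i t : smooth_along V -> I t -> chart_dom i (alpha t) ->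
  covder D alpha V t =
    \sum_k ('D_1 (fun s => V s i 0 k) t *: frame i k (alpha t)
            + V t i 0 k *: D (alpha t) (velocity alpha t) (frame i k)).
Proof.
move=> VC It it.
apply: (covder_fields (chart_open i) It it (f := fun k s => V s i 0 k)).
- exact: smooth_field_frame.
- by move=> k; exact: smooth_derivable_along.
apply: filterS (near_curve (chart_open i) It it) => s [Is is_].
by apply: tangent_coord => //; exact: VC.1.
Qed.


Lemma covder_tangent V t : I t -> tangent (alpha t) (covder D alpha V t).
Proof.
move=> It; rewrite /covder; set p := alpha t; set i := chart_at S p.
have ip : chart_dom i p by rewrite /i /chart_at; case: cid.
apply: tangent_sum => k; apply: tangentD.
  exact/tangentZ/tangent_frame.
apply/tangentZ/(nabla_tangent D (chart_open i) ip (smooth_field_frame i k)).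
exact: tangent_velocity.
Qed.

(** In a fixed chart j the components of nabla_{alpha'} V are polynomials in the
    components of V, of V' and of the velocity, and in the components of the
    fields nabla_{d/dx^m} d/dx^k, the Christoffel symbols, along alpha. *)
Lemma smooth_along_covder V : smooth_along V -> smooth_along (covder D alpha V).
Proof.
move=> VC; split=> [t|j n]; first exact: covder_tangent.
have oj := chart_open j; have oJ := open_curve_preimage oj.
set J := I `&` alpha @^-1` chart_dom j in oJ *.
pose Gam m k q := D q (frame j m q) (frame j k).
have GamC m k : smooth_field (chart_dom j) (Gam m k).
  exact: nabla_smooth (smooth_field_frame j m) (smooth_field_frame j k).
have coordC W k : smooth_along W -> Cn n J (fun s => W s j 0 k).
  by move=> WC; exact: ((Cn_coord _ _ oJ).1 (WC.2 j n) k).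
have V'C k : Cn n J (fun s => 'D_1 (fun r => V r j 0 k) s).
  have := (Cn_coord n.+1 _ oJ).1 (VC.2 j n.+1) k; case=> _; exact.
have GC m k l : Cn n J (fun s => Gam m k (alpha s) j 0 l).
  exact: ((Cn_coord _ _ oJ).1 (Cn_field_curve n (GamC m k)) l).
apply/(Cn_coord _ _ oJ) => l.
have velC := coordC _ _ smooth_along_velocity.
have := Cn_sum oJ (fun k => Cn_add oJ
  (Cn_mul oJ (V'C k) (Cn_cst n J ((l == k)%:R : R)))
  (Cn_mul oJ (coordC V k VC)
    (Cn_sum oJ (fun m => Cn_mul oJ (velC m) (GC m k l))))).
apply: Cn_ext => // s /set_mem[Is js].
rewrite (covder_chart VC Is js) fct_sumE summxE; apply: eq_bigr => k _.
rewrite !fctE !mxE (frameE k js js) (transition_diff_id _ js) mxE eqxx /=.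
congr (_ + _ * _).
rewrite {2}(tangent_coord js (tangent_velocity Is)).
have vt m : tangent (alpha s) (velocity alpha s j 0 m *: frame j m (alpha s)).
  exact/tangentZ/tangent_frame.
rewrite (nabla_sumv D oj js (smooth_field_frame j k) vt) fct_sumE summxE.
apply: eq_bigr => m _.
rewrite (nablaZ D _ oj js (smooth_field_frame j k) (tangent_frame m js)).
by rewrite !fctE mxE.
Qed.

Lemma covder_comb (f g : R -> R) V W t :
  derivable f t 1 -> derivable g t 1 ->
  derivable_along V t -> derivable_along W t ->
  tangent (alpha t) (V t) -> tangent (alpha t) (W t) ->
  covder D alpha (fun s => f s *: V s + g s *: W s) t =
    'D_1 f t *: V t + f t *: covder D alpha V t
    + ('D_1 g t *: W t + g t *: covder D alpha W t).
Proof.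
move=> fd gd Vd Wd Vt Wt.
rewrite /covder; set p := alpha t in Vt Wt *; set i := chart_at S p.
have ip : chart_dom i p by rewrite /i /chart_at; case: cid.
rewrite [X in _ = 'D_1 f t *: X + _ + _](tangent_coord ip Vt).
rewrite [X in _ = _ + ('D_1 g t *: X + _)](tangent_coord ip Wt).
rewrite !scaler_sumr -!big_split; apply: eq_bigr => k _ /=.
have -> : derive1 (fun s => (f s *: V s + g s *: W s) i 0 k) t =
    'D_1 f t * V t i 0 k + f t * derive1 (fun s => V s i 0 k) t
    + ('D_1 g t * W t i 0 k + g t * derive1 (fun s => W s i 0 k) t).
  pose Vk s := V s i 0 k; pose Wk s := W s i 0 k.
  have dV : derivable Vk t 1 := Vd i k ip.
  have dW : derivable Wk t 1 := Wd i k ip.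
  rewrite -/Vk -/Wk !derive1E.
  have -> : (fun s => (f s *: V s + g s *: W s) i 0 k) = f * Vk + g * Wk.
    by apply/funext => s; rewrite !fctE !mxE.
  rewrite (deriveD (derivableM fd dV) (derivableM gd dW)).
  rewrite (deriveM fd dV) (deriveM gd dW).
  rewrite (addrC (f t *: _)) (addrC (g t *: _)) (mulrC _ (V t i 0 k)).
  by rewrite (mulrC _ (W t i 0 k)).
have -> : (f t *: V t + g t *: W t) i 0 k = f t * V t i 0 k + g t * W t i 0 k.
  by rewrite !fctE !mxE.
rewrite !scalerDl !scalerDr !scalerA.
rewrite -!addrA; congr (_ + (_ + _)).
by rewrite [RHS]addrCA; congr (_ + _); exact: addrCA.
Qed.

Lemma derivable_alongZ (f : R -> R) V t : derivable f t 1 ->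
  derivable_along V t -> derivable_along (fun s => f s *: V s) t.
Proof.
move=> fd Vd i k it; pose Vk s := V s i 0 k.
have -> : (fun s => (f s *: V s) i 0 k) = f * Vk.
  by apply/funext => s; rewrite !fctE !mxE.
exact: (derivableM fd (Vd i k it)).
Qed.

Lemma derivable_alongD V W t : derivable_along V t -> derivable_along W t ->
  derivable_along (fun s => V s + W s) t.
Proof.
move=> Vd Wd i k it; pose Vk s := V s i 0 k; pose Wk s := W s i 0 k.
have -> : (fun s => (V s + W s) i 0 k) = Vk + Wk.
  by apply/funext => s; rewrite !fctE !mxE.
exact: (derivableD (Vd i k it) (Wd i k it)).
Qed.

Lemma covderZ (f : R -> R) V t : derivable f t 1 ->
  derivable_along V t -> tangent (alpha t) (V t) ->
  covder D alpha (fun s => f s *: V s) t =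
    'D_1 f t *: V t + f t *: covder D alpha V t.
Proof.
move=> fd Vd Vt; have d0 : derivable (cst (0 : R)) t 1 by exact: derivable_cst.
have := covder_comb fd d0 Vd Vd Vt Vt.
rewrite derive_cst !scale0r !addr0 => <-; congr (covder D alpha _ t).
by apply/funext => s; rewrite scale0r addr0.
Qed.

(** * Change of parameter *)

Lemma velocity_reparam (beta : R -> M) (tau : R -> R) s :
  I (tau s) -> derivable tau s 1 ->
  (\forall r \near s, beta r = alpha (tau r)) ->
  velocity beta s = 'D_1 tau s *: (velocity alpha (tau s) : tvec S).
Proof.
move=> It td be; have bs := nbhs_singleton be.
apply/funext => i; rewrite !fctE.
have [it|nit] := pselect (chart_dom i (alpha (tau s))); last first.
  rewrite /velocity !asboolF ?bs ?scaler0//.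
rewrite /velocity !asboolT ?bs//.
have dX := chart_curve_differentiable It it.
have dtau : differentiable tau s by exact/derivable1_diffP.
transitivity ('D_1 ((chart_map i \o alpha) \o tau) s).
  have -> : (chart_map i \o beta)^`()%classic s = 'D_1 (chart_map i \o beta) s.
    exact: derive1E.
  by apply: near_eq_derive; apply: filterS be => r /= ->.
have -> : (chart_map i \o alpha)^`()%classic (tau s) =
    'D_1 (chart_map i \o alpha) (tau s) by exact: derive1E.
exact: derive_comp_real.
Qed.

(** The velocity is scaled by tau' ([velocity_reparam]) and so is the derivative
    of every component. *)
Lemma covder_reparam (beta : R -> M) (tau : R -> R) V W s :
  I (tau s) -> derivable tau s 1 ->
  (\forall r \near s, beta r = alpha (tau r)) ->
  (\forall r \near s, W r = V (tau r)) -> derivable_along V (tau s) ->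
  covder D beta W s = 'D_1 tau s *: covder D alpha V (tau s).
Proof.
move=> It td be WV Vd; have bs := nbhs_singleton be.
rewrite /covder (velocity_reparam It td be) bs.
set p := alpha _; set i := chart_at S p.
have ip : chart_dom i p by rewrite /i /chart_at; case: cid.
rewrite scaler_sumr; apply: eq_bigr => k _.
rewrite (nablaZ D _ (chart_open i) ip (smooth_field_frame i k)
  (tangent_velocity It)).
rewrite (nbhs_singleton WV) scalerDr !scalerA [_ * V _ _ _ _]mulrC.
congr (_ *: _ + _).
pose Vk r := V r i 0 k.
have dV : differentiable Vk (tau s) by apply/derivable1_diffP; exact: (Vd i k ip).
have dtau : differentiable tau s by exact/derivable1_diffP.
rewrite -/Vk !derive1E.
transitivity ('D_1 (Vk \o tau) s).
  by apply: near_eq_derive; apply: filterS WV => r /= ->.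
exact: derive_comp_real.
Qed.

End AlongCurve.

(** * The volume form *)

Section VolumeForm.
Context {R : realType} {M : topologicalType} {S : surface R M}.
Variable Om : volume_form S.
Implicit Types (p q : M) (u v w : tvec S).

Lemma volumeDl p u v w : tangent p u -> tangent p v -> tangent p w ->
  Om p (u + v) w = Om p u w + Om p v w.
Proof.
by move=> up vp wp; rewrite -[u]scale1r volume_linear// mul1r scale1r.
Qed.

Lemma volume0l p w : tangent p w -> Om p 0 w = 0.
Proof.
move=> wp; have := volumeDl (tangent0 p) (tangent0 p) wp.
by rewrite addr0 => /eqP; rewrite -subr_eq subrr => /eqP.
Qed.

Lemma volumeZl p a v w : tangent p v -> tangent p w ->
  Om p (a *: v) w = a * Om p v w.
Proof.
move=> vp wp; rewrite -[a *: v]addr0 volume_linear//; last exact: tangent0.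
by rewrite volume0l// addr0.
Qed.

Lemma volume_suml p n (u : 'I_n -> tvec S) w : (forall k, tangent p (u k)) ->
  tangent p w -> Om p (\sum_k u k) w = \sum_k Om p (u k) w.
Proof.
move=> + wp; elim: n u => [|n IHn] u up; first by rewrite !big_ord0 volume0l.
by rewrite !big_ord_recl volumeDl// ?IHn//; exact: tangent_sum.
Qed.

Lemma volumeDr p u v w : tangent p u -> tangent p v -> tangent p w ->
  Om p w (u + v) = Om p w u + Om p w v.
Proof.
move=> up vp wp; have uvp := tangentD up vp.
rewrite (volume_antisymmetric Om wp uvp) volumeDl// opprD.
by rewrite -(volume_antisymmetric Om wp up) -(volume_antisymmetric Om wp vp).
Qed.

Lemma volumeZr p a v w : tangent p v -> tangent p w ->
  Om p w (a *: v) = a * Om p w v.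
Proof.
move=> vp wp; have avp := tangentZ a vp.
rewrite (volume_antisymmetric Om wp avp) volumeZl//.
by rewrite (volume_antisymmetric Om wp vp) mulrN.
Qed.

Lemma volume_sumr p n (u : 'I_n -> tvec S) w : (forall k, tangent p (u k)) ->
  tangent p w -> Om p w (\sum_k u k) = \sum_k Om p w (u k).
Proof.
move=> up wp; have sp := tangent_sum up.
rewrite (volume_antisymmetric Om wp sp) volume_suml// -sumrN.
by apply: eq_bigr => k _; rewrite -(volume_antisymmetric Om wp (up k)).
Qed.

Lemma volume_self p v : tangent p v -> Om p v v = 0.
Proof.
move=> vp; have /eqP := volume_antisymmetric Om vp vp.
by rewrite -addr_eq0 -mulr2n mulrn_eq0 => /eqP.
Qed.

(** Cramer's rule in the tangent plane: in coordinates Omega is a multiple of the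
    determinant, and the claim is a polynomial identity. *)
Lemma volume_cramer p u v w : tangent p u -> tangent p v -> tangent p w ->
  Om p u v *: w = Om p w v *: u + Om p u w *: v.
Proof.
move=> up vp wp; have [i ip] := chart_cover S p.
have rp : tangent p (Om p w v *: u + Om p u w *: v).
  by apply: tangentD; exact: tangentZ.
apply: (tangent_eq ip (tangentZ _ wp) rp).
pose c (x : tvec S) (k : 'I_2) : R := x i 0 k.
have OmE (x y : tvec S) : tangent p x -> tangent p y ->
    Om p x y = (c x 0 * c y 1 - c x 1 * c y 0) * Om p (frame i 0 p) (frame i 1 p).
  move=> xp yp.
  have F0 := tangent_frame 0 ip; have F1 := tangent_frame 1 ip.
  have T a k := tangentZ a (tangent_frame k ip).
  rewrite {1}(tangent_coord2 ip xp) {1}(tangent_coord2 ip yp) volumeDl//;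
    last exact: tangentD.
  rewrite -!/(c _ _) !volumeDr// !volumeZl// !volumeZr// !volume_self//.
  rewrite (volume_antisymmetric Om F1 F0).
  move: (c x 0) (c x 1) (c y 0) (c y 1) (Om p _ _) => x0 x1 y0 y1 o.
  by ring.
rewrite (OmE u v up vp) (OmE w v wp vp) (OmE u w up wp).
move: (Om p _ _) => om; apply/rowP => k.
rewrite !fctE !mxE -/(c w k) -/(c u k) -/(c v k).
have : k = 0 \/ k = 1 by case: k => -[|[|//]] h; [left|right]; exact/val_inj.
by case=> ->; move: (c u 0) (c u 1) (c v 0) (c v 1) (c w 0) (c w 1)
  => u0 u1 v0 v1 w0 w1; ring.
Qed.

End VolumeForm.

Section ProductRule.
Context {R : realType} {M : topologicalType} {S : surface R M}.
Variables (A : equiaffine S) (I : set R) (alpha : R -> M).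
Hypotheses (I_open : open I) (alpha_smooth : smooth_curve S I alpha).
Local Notation Om := (vol A).
Local Notation nab := (covder (conn A) alpha).

(** Omega(V, W) is a double sum of products of components of V and W with the
    functions Omega(d/dx^k, d/dx^l) along alpha, whose derivatives are given by
    the parallelism of Omega. *)
Lemma is_derive_volume V W t : smooth_along I alpha V ->
  smooth_along I alpha W -> I t ->
  is_derive t 1 (fun s => Om (alpha s) (V s) (W s))
    (Om (alpha t) (nab V t) (W t) + Om (alpha t) (V t) (nab W t)).
Proof.
move=> VC WC It; set p := alpha t.
have [i ip] := chart_cover S p; have oi := chart_open i.
have vp : tangent p (velocity alpha t) := tangent_velocity I_open alpha_smooth It.
set v := velocity alpha t in vp.
pose F k q := frame i k q; pose N k := conn A p v (frame i k).
have FC k : smooth_field (chart_dom i) (F k) := smooth_field_frame i k.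
have Fp k q : chart_dom i q -> tangent q (F k q) by exact: tangent_frame.
have Np k : tangent p (N k) := nabla_tangent (conn A) oi ip (FC k) vp.
pose om k l q := Om q (F k q) (F l q).
have omC k l : smooth_fun S (chart_dom i) (om k l).
  exact: volume_smooth (FC k) (FC l).
pose Vc k s := V s i 0 k; pose Wc k s := W s i 0 k.
have Vd k : is_derive t 1 (Vc k) ('D_1 (Vc k) t).
  by apply: derivableP; have := smooth_derivable_along VC It; apply.
have Wd k : is_derive t 1 (Wc k) ('D_1 (Wc k) t).
  by apply: derivableP; have := smooth_derivable_along WC It; apply.
pose dom k l := Om p (N k) (F l p) + Om p (F k p) (N l).
have omd k l : is_derive t 1 (om k l \o alpha) (dom k l).
  have := is_derive_curve I_open alpha_smooth oi (omC k l) It ip.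
  by rewrite (vol_parallel A oi ip (FC k) (FC l) vp).
have Ep s X : I s -> chart_dom i (alpha s) -> smooth_along I alpha X ->
    X s = \sum_k X s i 0 k *: F k (alpha s).
  by move=> Is is_ XC; apply: (tangent_coord is_); exact: XC.1.
pose g k s := \sum_l Wc l s * om k l (alpha s).
pose dg k := \sum_l ('D_1 (Wc l) t * om k l p + Wc l t * dom k l).
have gd k : is_derive t 1 (g k) (dg k).
  exact: (is_derive_sum_mul (g := fun l => om k l \o alpha) Wd (omd k)).
apply: (@near_eq_is_derive _ _ _ (fun s => \sum_k Vc k s * g k s)).
  apply: filterS (near_curve I_open alpha_smooth oi It ip) => s [Is is_].
  rewrite (Ep s V Is is_ VC) volume_suml; last exact: WC.1.
    apply: eq_bigr => k _; rewrite volumeZl; last 2 first.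
    - exact: Fp.
    - exact: WC.1.
    congr (_ * _); rewrite [in RHS](Ep s W Is is_ WC) volume_sumr; last exact: Fp.
      by apply: eq_bigr => l _; rewrite volumeZr//; exact: Fp.
    by move=> l; exact/tangentZ/Fp.
  by move=> k; exact/tangentZ/Fp.
have := is_derive_sum_mul Vd gd.
have Vtp := VC.1 t It; have Wtp := WC.1 t It.
have Fpp k : tangent p (F k p) by exact: Fp.
congr is_derive.
rewrite (covder_chart I_open alpha_smooth _ VC It ip).
rewrite (covder_chart I_open alpha_smooth _ WC It ip).
have aFp a l : tangent p (a *: F l p) := tangentZ a (Fpp l).
have aNp a l : tangent p (a *: N l) := tangentZ a (Np l).
have FNp a b l : tangent p (a *: F l p + b *: N l) :=
  tangentD (aFp a l) (aNp b l).
have DWp : tangent p (\sum_l ('D_1 (Wc l) t *: F l p + Wc l t *: N l)).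
  exact: tangent_sum.
rewrite (volume_suml Om (fun k => FNp ('D_1 (Vc k) t) (Vc k t) k) Wtp).
rewrite [X in _ = _ + Om _ X _](Ep t V It ip VC).
rewrite (volume_suml Om (fun k => aFp (Vc k t) k) DWp) -big_split.
apply: eq_bigr => k _ /=.
rewrite (volumeDl Om (aFp _ _) (aNp _ _) Wtp).
rewrite (volumeZl Om _ (Fpp k) Wtp) (volumeZl Om _ (Np k) Wtp).
rewrite (volumeZl Om _ (Fpp k) DWp).
rewrite (volume_sumr Om (fun l => FNp _ _ l) (Fpp k)).
have OmW u : tangent p u -> Om p u (W t) = \sum_l Wc l t * Om p u (F l p).
  move=> up; rewrite {1}(Ep t W It ip WC).
  rewrite (volume_sumr Om (fun l => aFp (Wc l t) l) up).
  by apply: eq_bigr => l _; rewrite (volumeZr Om _ (Fpp l) up).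
rewrite (OmW _ (Fpp k)) (OmW _ (Np k)) -addrA; congr (_ + _).
rewrite -mulrDr -big_split; congr (_ * _); apply: eq_bigr => l _ /=.
rewrite (volumeDr Om (aFp _ _) (aNp _ _) (Fpp k)).
rewrite (volumeZr Om _ (Fpp l) (Fpp k)) (volumeZr Om _ (Np l) (Fpp k)).
by rewrite /dom mulrDr addrCA.
Qed.

End ProductRule.

(** * Arclength, its inverse, and real cube roots *)

Section RealAnalysis.
Context {R : realType}.

Lemma open_enlarge (I : set R) t : open I -> I t ->
  exists a b, [/\ a < t, t < b, I a & I b].
Proof.
move=> oI It; have /nbhs_ballP[e /= e0 eI] : nbhs t I by exact: open_nbhs_nbhs.
have e2 : 0 < e / 2 by rewrite divr_gt0.
have lt_e : e / 2 < e by rewrite ltr_pdivrMr// ltr_pMr// ltr1n.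
exists (t - e / 2), (t + e / 2); split.
- by rewrite ltrBlDr ltrDl.
- by rewrite ltrDl.
- by apply: eI; rewrite /ball/= opprB addrC subrK gtr0_norm.
- by apply: eI; rewrite /ball/= opprD addrA subrr add0r normrN gtr0_norm.
Qed.

(** A base point a to the left of both t0 and t replaces the two cases of the
    definition by one: near t the oriented integral is F - F t0, where F is the
    integral from a.  This also covers t = t0, where both cases meet. *)
Lemma is_derive_oriented_integral (I : set R) (f : R -> R) t0 t :
  open I -> is_interval I -> (forall s, I s -> {for s, continuous f}) ->
  I t0 -> I t -> is_derive t 1 (oriented_integral f t0) (f t).
Proof.
move=> oI iI fc It0 It.
have Imin : I (Num.min t0 t) by rewrite /Num.min; case: ifP.
have Imax : I (Num.max t0 t) by rewrite /Num.max; case: ifP.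
have [a [_ [amin _ Ia _]]] := open_enlarge oI Imin.
have [_ [b [_ maxb _ Ib]]] := open_enlarge oI Imax.
move: amin maxb; rewrite lt_min gt_max => /andP[a0 at_] /andP[b0 bt].
have fint : lebesgue_measure.-integrable `[a, b] (EFin \o f).
  apply: continuous_compact_integrable; first exact: segment_compact.
  apply: continuous_in_subspaceT => s /set_mem/=; rewrite in_itv/= => /andP[s1 s2].
  by apply: fc; apply: (iI a b) => //; rewrite s1.
have subint (i : interval R) : [set` i] `<=` `[a, b] ->
    lebesgue_measure.-integrable [set` i] (EFin \o f).
  by move=> ?; apply: integrableS fint => //; exact: measurable_itv.
pose F y := \int[lebesgue_measure]_(u in `[a, y]) f u.
have [Fd FE] : derivable F t 1 /\ F^`()%classic t = f t.
  by apply: (continuous_FTC1_closed bt fint at_); exact: fc.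
have splitF x y : a < x -> x <= y -> y < b ->
    \int[lebesgue_measure]_(u in `[x, y]) f u = F y - F x.
  move=> ax xy yb.
  rewrite /F Rintegral_itvB ?bnd_simp//; last 2 first.
  - by apply: subint; apply: subset_itvl; rewrite bnd_simp ltW.
  - exact: ltW.
  rewrite Rintegral_itv_obnd_cbnd//; apply: subint.
  by apply: subset_itv; rewrite bnd_simp ltW.
have FD : is_derive t 1 (F - cst (F t0)) (f t).
  apply: (is_derive_eq (is_deriveB (derivableP Fd) (is_derive_cst _ _ _))).
  by rewrite subr0 -derive1E.
apply: near_eq_is_derive FD.
have : \forall y \near t, y \in `]a, b[ by apply: near_in_itvoo; rewrite in_itv/= at_.
apply: filterS => y; rewrite in_itv/= => /andP[ay yb].
rewrite !fctE /oriented_integral; case: leP => [le0|/ltW le0].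
  by rewrite splitF.
by rewrite splitF// opprB.
Qed.

(** By Rolle's theorem on the segment between two points with the same image. *)
Lemma derive_neq0_injective (I : set R) (f df : R -> R) : is_interval I ->
  (forall t, I t -> is_derive t 1 f (df t)) -> (forall t, I t -> df t != 0) ->
  {in I &, injective f}.
Proof.
move=> iI fd df0; suff lt_inj s t : I s -> I t -> s < t -> f s <> f t.
  move=> s t /set_mem Is /set_mem It fst.
  by case: (ltgtP s t) => // st; [case: (lt_inj s t)|case: (lt_inj t s)].
move=> Is It st fst.
have Ic c : c \in `[s, t] -> I c by rewrite in_itv/= => cst; exact: (iI s t).
have Ioo c : c \in `]s, t[ -> I c by move/subset_itv_oo_cc; exact: Ic.
have [c /Ioo Ic' [_ c0]] : exists2 c, c \in `]s, t[%R & is_derive c 1 f 0.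
  apply: Rolle => // [x /Ioo Ix|]; first by case: (fd x Ix).
  apply: derivable_within_continuous => x /Ic Ix; by case: (fd x Ix).
by have := df0 c Ic'; case: (fd c Ic') => _ <-; rewrite c0 eqxx.
Qed.

(** The inverse is given by choice in the fibres of f, and injectivity on I makes
    it a left inverse.  It is differentiable at f t by the inverse function
    theorem, hence continuous, so that it keeps its values in I near f t. *)
Lemma is_derive_get_inverse (I : set R) (f df : R -> R) t :
  open I -> is_interval I -> (forall t, I t -> is_derive t 1 f (df t)) ->
  (forall t, I t -> df t != 0) -> I t ->
  let g s := get [set r | I r /\ f r = s] in
  g (f t) = t /\
  \forall s \near f t, I (g s) /\ is_derive s 1 g (df (g s))^-1.
Proof.
move=> oI iI fd df0 It g.
have finj := derive_neq0_injective iI fd df0.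
have gK r : I r -> g (f r) = r.
  move=> Ir; have [|Ig gE] := @getPex _ [set q | I q /\ f q = f r].
    by exists r.
  by apply: finj => //; exact: mem_set.
have nearI r : I r -> \forall s \near r, I s by move=> Ir; exact: open_nbhs_nbhs.
have fcan r : I r -> {near r, cancel f g}.
  by move=> /nearI; apply: filterS => s /gK.
have fcont r : I r -> {near r, continuous f}.
  move=> /nearI; apply: filterS => s Is.
  by apply/differentiable_continuous/derivable1_diffP; case: (fd s Is).
have gd r : I r -> is_derive (f r) 1 g (df r)^-1.
  by move=> Ir; apply: is_derive_inverse (fd r Ir) (df0 r Ir); [exact: fcan|exact: fcont].
split; first exact: gK.
have nIg : \forall s \near f t, I (g s).
  have gc : {for f t, continuous g}.
    by apply/differentiable_continuous/derivable1_diffP; case: (gd t It).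
  by apply: gc; rewrite /= gK//; exact: nearI.
apply: filterS2 nIg (near_continuous_can_sym (fcont t It) (fcan t It)).
by move=> s Ig fgs; split=> //; have := gd _ Ig; rewrite fgs.
Qed.

Lemma sgr3 (x : R) : Num.sg x ^+ 3 = Num.sg x.
Proof.
rewrite exprS sqr_sg.
by case: (eqVneq x 0) => [->|_]; rewrite ?sgr0 ?mul0r ?mulr1.
Qed.

Lemma cbrtK (x : R) : cbrt x ^+ 3 = x.
Proof.
rewrite /cbrt exprMn sgr3 -[X in _ * X]powR_mulrn ?powR_ge0// -powRrM.
by rewrite mulVf ?pnatr_eq0// powRr1// mulr_sg_norm.
Qed.

Lemma exprK_cbrt (x : R) : cbrt (x ^+ 3) = x.
Proof.
rewrite /cbrt sgrX sgr3 normrX -powR_mulrn// -powRrM mulfV ?pnatr_eq0//.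
by rewrite powRr1// mulr_sg_norm.
Qed.

Lemma cbrt_eq0 (x : R) : (cbrt x == 0) = (x == 0).
Proof. by rewrite -[in RHS](cbrtK x) expf_eq0. Qed.

(** As the inverse of the cube, which avoids any case distinction on the sign. *)
Lemma is_derive_cbrt (x : R) : x != 0 ->
  is_derive x 1 cbrt (3 * cbrt x ^+ 2)^-1.
Proof.
move=> x0; rewrite -{1}(cbrtK x).
apply: (@is_derive_inverse _ (fun y => y ^+ 3)).
- by near=> y; exact: exprK_cbrt.
- by near=> y; exact: exprn_continuous.
- apply: is_derive_eq; rewrite /GRing.scale /= mulr1 mulr_natl; ring.
- by rewrite mulf_neq0 ?pnatr_eq0// expf_neq0// cbrt_eq0.
Unshelve. all: by end_near. Qed.

End RealAnalysis.

(** * The curvature *)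

Section Curvature.
Context {R : realType} {M : topologicalType} {S : surface R M}.
Variables (A : equiaffine S) (I : set R) (alpha : R -> M).
Hypotheses (I_open : open I) (I_interval : is_interval I).
Hypotheses (alpha_smooth : smooth_curve S I alpha).
Hypotheses (alpha_nondegenerate : nondegenerate_curve A I alpha).
Local Notation Om := (vol A).
Local Notation nab := (covder (conn A) alpha).
Let v := velocity alpha : R -> tvec S.
Let a := acceleration A alpha.
Let j := jerk A alpha.
Let w t := Om (alpha t) (v t) (a t).
Let w1 t := Om (alpha t) (v t) (j t).
Let psi t := (cbrt (w t))^-1.
(** The derivative of psi, as psi = w^(-1/3) and w' = w1. *)
Let psi1 t := - (3^-1 * psi t ^+ 4 * w1 t).
(** Half of the derivative of psi^2. *)
Let chi t := psi t * psi1 t.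

Let vC : smooth_along I alpha v := smooth_along_velocity I_open alpha_smooth.
Let aC : smooth_along I alpha a :=
  smooth_along_covder I_open alpha_smooth (conn A) vC.
Let jC : smooth_along I alpha j :=
  smooth_along_covder I_open alpha_smooth (conn A) aC.

Let w_neq0 t : I t -> w t != 0. Proof. exact: alpha_nondegenerate. Qed.

Let is_derive_w t : I t -> is_derive t 1 w (w1 t).
Proof.
move=> It; have := is_derive_volume A I_open alpha_smooth vC aC It.
by rewrite (volume_self Om (aC.1 t It)) add0r.
Qed.

Let is_derive_psi t : I t -> is_derive t 1 psi (psi1 t).
Proof.
move=> It; have cw0 : cbrt (w t) != 0 by rewrite cbrt_eq0; exact: w_neq0.
have cD := is_derive1_comp (is_derive_cbrt (w_neq0 It)) (is_derive_w It).
apply: (is_derive_eq (is_deriveV (f := cbrt \o w) cw0 cD)).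
rewrite /psi1 /psi /GRing.scale /=.
by move: (cbrt (w t)) (w1 t) cw0 => x y x0; field.
Qed.

Let derivable_psi1 t : I t -> derivable psi1 t 1.
Proof.
move=> It; have [w1d _] := is_derive_volume A I_open alpha_smooth vC jC It.
have -> : psi1 = - ((3^-1 *: psi ^+ 4) * w1).
  by apply/funext => s; rewrite /psi1 !fctE.
have w1d' : derivable w1 t 1 by exact: w1d.
have [p4 _] := is_deriveX 4 (is_derive_psi It).
have q4 := derivableZ (k := 3^-1) p4.
exact: (derivableN (derivableM q4 w1d')).
Qed.

Let derivable_chi t : I t -> derivable chi t 1.
Proof.
move=> It; have [pd _] := is_derive_psi It.
exact: (derivableM pd (derivable_psi1 It)).
Qed.

Let is_derive_psi2 t : I t -> is_derive t 1 (fun s => psi s ^+ 2) (2 * chi t).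
Proof.
move=> It; have pd := is_derive_psi It.
have -> : (fun s => psi s ^+ 2) = psi ^+ 2 by apply/funext => s; rewrite !fctE.
apply: (is_derive_eq (is_deriveX 2 pd)).
by rewrite /GRing.scale /= /chi expr1 mulrA.
Qed.

Let derive_chi t : I t ->
  'D_1 chi t = 2^-1 * derive1n 2 (fun s => psi s ^+ 2) t.
Proof.
move=> It; pose f := derive1 (fun s => psi s ^+ 2).
have -> : derive1n 2 (fun s => psi s ^+ 2) t = 'D_1 f t by exact: derive1E.
have -> : 'D_1 f t = 'D_1 (2 *: chi) t.
  apply: near_eq_derive; have : \forall s \near t, I s by exact: open_nbhs_nbhs.
  apply: filterS => s Is; rewrite /f derive1E.
  by case: (is_derive_psi2 Is) => _ ->.
by rewrite (deriveZ 2 (derivable_chi It)) /GRing.scale /= mulrA mulVf ?mul1r.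
Qed.

Lemma curvature_arclength t0 t : I t0 -> I t ->
  curvature A I alpha t0 t =
    - (2^-1 * derive1n 2 (fun s => psi s ^+ 2) t)
    + psi t ^+ 5 * Om (alpha t) (a t) (j t).
Proof.
move=> It0 It; rewrite -(derive_chi It) /curvature /arclength_curvature.
set beta := arclength_reparam A I alpha t0.
set sigma := arclength A alpha t0.
have mu_neq0 s : I s -> cbrt (w s) != 0.
  by move=> Is; rewrite cbrt_eq0; exact: w_neq0.
have sigmaD s : I s -> is_derive s 1 sigma (cbrt (w s)).
  move=> Is; apply: (is_derive_oriented_integral I_open I_interval _ It0 Is).
  move=> r Ir; apply/differentiable_continuous/derivable1_diffP.
  by case: (is_derive1_comp (is_derive_cbrt (w_neq0 Ir)) (is_derive_w Ir)).
pose tau s := get [set r | I r /\ sigma r = s].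
have [tauE tauD] : tau (sigma t) = t /\
    \forall s \near sigma t, I (tau s) /\ is_derive s 1 tau (psi (tau s)).
  exact: (is_derive_get_inverse I_open I_interval sigmaD mu_neq0 It).
have betaE s : beta s = alpha (tau s) by [].
have betan (s : R) : \forall r \near s, beta r = alpha (tau r)
  by exact: filterE.
(* At good parameters the chain rule for beta = alpha(tau) applies.  To
   differentiate once more, the parameters nearby have to be good as well. *)
pose good s := I (tau s) /\ is_derive s 1 tau (psi (tau s)).
have good_t : good (sigma t) by exact: nbhs_singleton tauD.
have velE (s : R) : good s -> velocity beta s = psi (tau s) *: v (tau s).
  move=> [Is [td tE]].
  by rewrite (velocity_reparam alpha_smooth Is td (betan s)) tE.
have vd s : I s -> derivable_along alpha v s by exact: smooth_derivable_along.
have ad s : I s -> derivable_along alpha a s by exact: smooth_derivable_along.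
have accE (s : R) : (\forall r \near s, good r) ->
    acceleration A beta s =
      chi (tau s) *: v (tau s) + psi (tau s) ^+ 2 *: a (tau s).
  move=> gs; have [Is [td tE]] : good s by exact: nbhs_singleton gs.
  have [pd pE] := is_derive_psi Is.
  have velE' : \forall r \near s, velocity beta r = psi (tau r) *: v (tau r).
    by apply: filterS gs => r; exact: velE.
  have pvd := derivable_alongZ pd (vd _ Is).
  rewrite /acceleration.
  rewrite (covder_reparam I_open alpha_smooth _ Is td (betan s) velE' pvd).
  rewrite (covderZ _ pd (vd _ Is) (vC.1 _ Is)) pE tE scalerDr !scalerA.
  by rewrite -expr2.
have jerkE : jerk A beta (sigma t) = psi t *:
    ('D_1 chi t *: v t + chi t *: a t + ((2 * chi t) *: a t + psi t ^+ 2 *: j t)).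
  have [_ [td tE]] := good_t.
  have Its : I (tau (sigma t)) by rewrite tauE.
  have accn : \forall s \near sigma t, acceleration A beta s =
      chi (tau s) *: v (tau s) + psi (tau s) ^+ 2 *: a (tau s).
    by apply: filterS (near_join tauD) => s; exact: accE.
  have cd := derivable_chi It; have [p2d p2E] := is_derive_psi2 It.
  pose V r := chi r *: v r + psi r ^+ 2 *: a r.
  have Vd : derivable_along alpha V (tau (sigma t)).
    rewrite tauE.
    exact: (derivable_alongD (derivable_alongZ cd (vd _ It))
      (derivable_alongZ p2d (ad _ It))).
  rewrite /jerk (covder_reparam I_open alpha_smooth _ Its td (betan _) accn Vd).
  rewrite tE tauE; congr (_ *: _).
  rewrite (covder_comb _ cd p2d (vd _ It) (ad _ It) (vC.1 _ It) (aC.1 _ It)).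
  by rewrite p2E.
have velt : velocity beta (sigma t) = psi t *: v t by rewrite (velE _ good_t) tauE.
have cw0 : cbrt (w t) != 0 by exact: mu_neq0.
have psi0 : psi t != 0 by rewrite invr_neq0.
have psi3 : psi t ^+ 3 * w t = 1.
  rewrite /psi -{2}(cbrtK (w t)).
  by move: (cbrt (w t)) cw0 => x x0; field.
(* The jerk in the basis (v, a), by Cramer's rule. *)
have jerk_decomp : j t = psi t ^+ 3 *:
    (- Om (alpha t) (a t) (j t) *: v t + w1 t *: a t).
  have vt := vC.1 t It; have at_ := aC.1 t It; have jt := jC.1 t It.
  rewrite -(volume_antisymmetric Om jt at_) -(volume_cramer Om vt at_ jt).
  by rewrite scalerA psi3 scale1r.
set kappa := RHS.
have kappaP : jerk A beta (sigma t) = - (kappa *: velocity beta (sigma t)).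
  rewrite jerkE velt jerk_decomp -scaleNr !scalerDr !scalerA.
  rewrite [X in _ + X]addrCA addrACA -!scalerDl.
  (* The coefficient of a: psi chi + 2 psi chi + psi^6 w1 = 0. *)
  rewrite [X in _ + X *: a t](_ : _ = 0) ?scale0r ?addr0; last first.
    rewrite /chi /psi1; move: (psi t) (w1 t) => x y.
    by field.
  congr (_ *: _); rewrite /kappa.
  by move: (psi t) ('D_1 chi t) (Om _ _ _) => x y z; ring.
pose K := [set k | jerk A beta (sigma t) = - (k *: velocity beta (sigma t))].
have kE : K (get K) := @getI _ K kappa kappaP.
(* Pairing with a recovers the factor, so that the choice is forced. *)
move: kE; rewrite /K /= {1}kappaP velt !scalerA => /oppr_inj.
move=> /(congr1 (fun u => Om (alpha t) u (a t))).
rewrite !(volumeZl Om _ (vC.1 t It) (aC.1 t It)).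
by move=> /(mulIf (w_neq0 It)) /(mulIf psi0).
Qed.

End Curvature.

Theorem theorem1 (R : realType) (M : topologicalType) (S : surface R M)
    (A : equiaffine S) (I : set R) (alpha : R -> M)
    (I_open : open I) (I_interval : is_interval I)
    (alpha_smooth : smooth_curve S I alpha)
    (alpha_nondegenerate : nondegenerate_curve A I alpha)
    (t0 : R) (It0 : I t0) :
  let psi := fun t : R =>
    (cbrt (vol A (alpha t) (velocity alpha t) (acceleration A alpha t)))^-1 in
  forall t, I t ->
    curvature A I alpha t0 t =
      - (2%:R^-1 * derive1n 2 (fun s => psi s ^+ 2) t)
      + psi t ^+ 5 * vol A (alpha t) (acceleration A alpha t) (jerk A alpha t).
Proof.
move=> psi t It.
exact: curvature_arclength.
Qed.
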